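(* The clones $\langle\mathrm{End}(\mathbb{Q},betw)\rangle$, $\langle\mathrm{End}(\mathbb{Q},circ)\rangle$ and $\langle\mathrm{End}(\mathbb{Q},sep)\rangle$ have automatic homeomorphicity: for each such clone $D$ and every countable set $\Omega$, every clone isomorphism from $D$ onto a closed subclone of $\mathcal{O}_\Omega$ is a homeomorphism.
   Context: On $\mathbb{Q}$: $betw(x,y,z)$ iff $x\le y\le z$ or $z\le y\le x$; $circ(x,y,z)$ iff $x\le y\le z$ or $y\le z\le x$ or $z\le x\le y$; $sep(x,y,z,t)$ iff ($circ(x,y,z)\wedge circ(x,t,y)$) or ($circ(x,z,y)\wedge circ(x,y,t)$). For $R$ one of these, $\mathrm{End}(\mathbb{Q},R)$ is the monoid of all maps $\mathbb{Q}\to\mathbb{Q}$ preserving $R$. For a monoid $M$ of unary maps on $\mathbb{Q}$, $\langle M\rangle$ denotes the clone generated by $M$, i.e. the smallest subset of $\mathcal{O}_{\mathbb{Q}}$ containing $M$ and all projections and closed under composition. $\mathcal{O}_A$ is the set of all finitary operations on $A$; a clone isomorphism is a bijection preserving arities, projections and composition. Clones carry the topology of pointwise convergence on each arity (topological sum over arities of the pointwise-convergence topologies). *)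

(* Defs.v *)
From HB Require Import structures.
From mathcomp Require Import all_boot all_order all_algebra.
From mathcomp Require Import all_classical all_reals topology.
Set Implicit Arguments.
Unset Strict Implicit.
Unset Printing Implicit Defensive.
Import Order.TTheory GRing.Theory Num.Theory.
Local Open Scope classical_set_scope.
Local Open Scope ring_scope.

(** * Finitary operations and clones *)

(* The alias [discrete_topology] is essential: it prevents the usual (order)
   topology of [rat] from being inferred. *)
Definition op (A : choiceType) (n : nat) : topologicalType :=
  {ptws ('I_n -> A) -> discrete_topology A}.

(* [sigT] carries the topological sum topology. Nullary operations are allowed;
   a clone generated by unary operations contains none of them. *)
Definition ops (A : choiceType) : topologicalType := {n : nat & op A n}.

Definition mkops (A : choiceType) (n : nat) (f : op A n) : ops A :=
  existT (op A) n f.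

Definition op_proj (A : choiceType) (n : nat) (i : 'I_n) : op A n :=
  fun x => x i.
Arguments op_proj A {n} i.

Definition op_comp (A : choiceType) (m n : nat)
    (f : op A m) (g : 'I_m -> op A n) : op A n :=
  fun x => f (fun i => g i x).

Definition op_unary (A : choiceType) (u : A -> A) : op A 1 :=
  fun x => u (x ord0).

Definition is_clone (A : choiceType) (C : set (ops A)) : Prop :=
  (forall (n : nat) (i : 'I_n), C (mkops (op_proj A i))) /\
  (forall (m n : nat) (f : op A m) (g : 'I_m -> op A n),
     C (mkops f) -> (forall i, C (mkops (g i))) -> C (mkops (op_comp f g))).

Definition clone_gen (A : choiceType) (M : set (A -> A)) : set (ops A) :=
  smallest (@is_clone A) [set mkops (op_unary u) | u in M].

(** * Clone isomorphisms and automatic homeomorphicity *)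

(* An arity-preserving map is given as a family of maps, one for each arity.
   Only its values on the clone [C] under consideration are relevant. *)
Definition ops_map (A B : choiceType) (phi : forall n, op A n -> op B n) :
  ops A -> ops B := fun f => mkops (phi (tag f) (tagged f)).

Definition clone_iso (A B : choiceType) (C : set (ops A)) (E : set (ops B))
    (phi : forall n, op A n -> op B n) : Prop :=
  [/\ set_bij C E (ops_map phi),
      (forall (n : nat) (i : 'I_n), phi n (op_proj A i) = op_proj B i) &
      (forall (m n : nat) (f : op A m) (g : 'I_m -> op A n),
         C (mkops f) -> (forall i, C (mkops (g i))) ->
         phi n (op_comp f g) = op_comp (phi m f) (fun i => phi n (g i)))].

(* [f] restricts to a homeomorphism from the subspace [C] onto the subspace
   [E]. *)
Definition homeomorphism_on (S T : topologicalType) (C : set S) (E : set T)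
    (f : S -> T) : Prop :=
  [/\ set_bij C E f, {within C, continuous f} &
      exists g : T -> S, {in C, cancel f g} /\ {within E, continuous g}].

Definition automatic_homeomorphicity (A : choiceType) (D : set (ops A)) : Prop :=
  forall (Omega : countType) (E : set (ops Omega)),
    is_clone E -> closed E ->
    forall phi : forall n, op A n -> op Omega n,
      clone_iso D E phi -> homeomorphism_on D E (ops_map phi).

(** * Endomorphism monoids of relations on the rationals *)

Definition End3 (A : Type) (R : A -> A -> A -> Prop) : set (A -> A) :=
  [set u | forall x y z, R x y z -> R (u x) (u y) (u z)].

Definition End4 (A : Type) (R : A -> A -> A -> A -> Prop) : set (A -> A) :=
  [set u | forall x y z t, R x y z t -> R (u x) (u y) (u z) (u t)].

Definition betw (x y z : rat) : bool := (x <= y <= z) || (z <= y <= x).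

Definition circ (x y z : rat) : bool :=
  [|| x <= y <= z, y <= z <= x | z <= x <= y].

Definition sep (x y z t : rat) : bool :=
  (circ x y z && circ x t y) || (circ x z y && circ x y t).

(* Main.v *)
(* Essentially unary clones: every member of <M> is [f] applied to one
   coordinate, so everything reduces to the action of M on Omega by
   [act f b = phi f (b)]. Constants are recognised algebraically, which embeds
   the rationals in Omega equivariantly (by [theta]) and makes the inverse of an
   isomorphism [phi] continuous. The isomorphism itself is continuous as soon as
   every point [b] of Omega satisfies [g b = b] for some [g] in M of finite
   image: then [f b = (f g) b] depends only on the restriction of [f] to the
   image of [g]. The only property of M used is that it contains all
   nondecreasing maps.

   To find [g], one builds nondecreasing maps [J y], for y an infinite binary
   sequence, such that for x, y splitting at level m with x < y, some
   nondecreasing R_L has [R_L o J y = clamp L] (truncation to [-L, L]), while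
   [R_L o J x] has its image in the first m + 1 rationals and does not depend on
   L for L large. As Omega is countable, [J x b = J y b] for some x <> y, whence
   [clamp L b = g b] for all large L, with [g] of finite image. Finally clamp L
   tends to the identity, so the map [b |-> lim_L clamp L b] belongs to the
   closed clone and is the image of the identity; hence [g b = b]. Closedness
   cannot be dropped here: a countable set on which the monoid acts may detect
   whether a map is unbounded. *)
Require Import Defs.
From mathcomp Require Import all_boot all_order all_algebra.
From mathcomp Require Import all_classical all_reals topology.
From mathcomp Require Import lra zify.
Set Implicit Arguments.
Unset Strict Implicit.
Unset Printing Implicit Defensive.
Import Order.TTheory GRing.Theory Num.Theory.
Local Open Scope classical_set_scope.
Local Open Scope ring_scope.

(** * Extrema and separation of finite families *)

Lemma seq_has_max (I : eqType) (f : I -> rat) (s : seq I) :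
  s = [::] \/ exists2 a, a \in s & forall b, b \in s -> f b <= f a.
Proof.
elim: s => [|x s [->|[a sa amax]]]; first by left.
  by right; exists x; rewrite ?mem_head // => b; rewrite inE => /eqP ->.
right; have [xa|ax] := leP (f x) (f a).
  exists a; first by rewrite inE sa orbT.
  by move=> b; rewrite inE => /predU1P[->|/amax].
exists x; first exact: mem_head.
move=> b; rewrite inE => /predU1P[->//|/amax ba].
exact: le_trans ba (ltW ax).
Qed.

Lemma filter_has_max (I : eqType) (f : I -> rat) (s : seq I) (P : pred I) :
  (forall a, a \in s -> ~~ P a) \/
  exists a, [/\ a \in s, P a & forall b, b \in s -> P b -> f b <= f a].
Proof.
have [s0|[a]] := seq_has_max f ([seq a <- s | P a]).
  left=> a sa; apply/negP => Pa.
  by have := sa; rewrite -[_ \in s]andTb -Pa -mem_filter s0.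
rewrite mem_filter => /andP[Pa sa] amax; right; exists a; split=> // b sb Pb.
by apply: amax; rewrite mem_filter Pb.
Qed.

Lemma separate_seqs (s t : seq rat) :
  (forall x y, x \in s -> y \in t -> x < y) ->
  exists q, (forall x, x \in s -> x < q) /\ (forall y, y \in t -> q < y).
Proof.
move=> st.
have [->|[a sa amax]] := seq_has_max id s;
  have [->|[b tb bmin]] := seq_has_max -%R t.
- by exists 0.
- exists (b - 1); split=> // y /bmin; lra.
- by exists (a + 1); split=> // x /amax /=; lra.
- have ab := st _ _ sa tb; exists ((a + b) / 2); split.
    by move=> x /amax /=; lra.
  by move=> y /bmin; lra.
Qed.

(** * Countable chains as monotone images of the rationals *)

Section MonotoneSurjection.
Variables (T : Type) (le : T -> T -> Prop) (v : nat -> T).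
Hypotheses (leT_trans : forall s t u, le s t -> le t u -> le s u)
  (leT_anti : forall s t, le s t -> le t s -> s = t)
  (leT_total : forall s t, le s t \/ le t s).

Let leT_refl s : le s s.
Proof. by case: (leT_total s s). Qed.

(* A pair [(q, n)] stands for the assignment of [v n] to [q]. *)
Definition mono_graph (s : seq (rat * nat)) : Prop :=
  forall a b, a \in s -> b \in s -> a.1 <= b.1 -> le (v a.2) (v b.2).

Lemma mono_graph_cons (q : rat) (n : nat) (s : seq (rat * nat)) :
  mono_graph s ->
  (forall a, a \in s -> (a.1 <= q -> le (v a.2) (v n)) /\
                        (q <= a.1 -> le (v n) (v a.2))) ->
  mono_graph ((q, n) :: s).
Proof.
move=> ms qs a b; rewrite !inE => /predU1P[->|sa] /predU1P[->|sb] //=.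
- by have [_ +] := qs _ sb; exact.
- by have [+ _] := qs _ sa; exact.
- exact: ms.
Qed.

(** Values may repeat, so [q] copies its nearest listed neighbour on the left, or the least listed
    point if there is none. *)
Lemma mono_graph_forth (s : seq (rat * nat)) (q : rat) :
  mono_graph s -> exists n, mono_graph ((q, n) :: s).
Proof.
move=> ms.
have [qs|[a [sa aq amax]]] := filter_has_max fst s (fun a => a.1 <= q).
  have [s0|[a sa amin]] := seq_has_max (fun a : rat * nat => - a.1) s.
    by exists 0%N; apply: mono_graph_cons => // a; rewrite s0.
  exists a.2; apply: mono_graph_cons => // b sb; split=> [bq|_].
    by have := qs _ sb; rewrite bq.
  by apply: ms => //; have := amin _ sb; rewrite lerN2.
exists a.2; apply: mono_graph_cons => // b sb; split=> [bq|qb].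
  by apply: ms => //; exact: amax.
by apply: ms => //; exact: le_trans qb.
Qed.

(** A value already taken keeps its point; otherwise the points of smaller value lie strictly left
    of those of larger value, and some rational separates them. *)
Lemma mono_graph_back (s : seq (rat * nat)) (n : nat) :
  mono_graph s -> exists q, mono_graph ((q, n) :: s).
Proof.
move=> ms.
have [[a [sa an]]|ns] := pselect (exists a, a \in s /\ v a.2 = v n).
  exists a.1; apply: mono_graph_cons => // b sb.
  by rewrite -an; split; apply: ms.
pose A := [seq a.1 | a <- s & `[< le (v a.2) (v n) >]].
pose B := [seq a.1 | a <- s & `[< le (v n) (v a.2) >]].
have [x y|q [Aq qB]] := @separate_seqs A B.
  move=> /mapP[a + ->] /mapP[b + ->]; rewrite !mem_filter.
  move=> /andP[/asboolP an sa] /andP[/asboolP nb sb].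
  rewrite ltNge; apply/negP => /(ms _ _ sb sa) ba.
  by apply: ns; exists a; split => //; apply: leT_anti => //; exact: leT_trans ba.
exists q; apply: mono_graph_cons => // a sa; split => [aq|qa].
  have [//|na] := leT_total (v a.2) (v n).
  suff : q < a.1 by rewrite ltNge aq.
  by apply: qB; apply: map_f; rewrite mem_filter sa andbT; apply/asboolP.
have [an|//] := leT_total (v a.2) (v n).
suff : a.1 < q by rewrite ltNge qa.
by apply: Aq; apply: map_f; rewrite mem_filter sa andbT; apply/asboolP.
Qed.

Lemma monotone_surjection : exists p : rat -> T,
  [/\ forall q r, q <= r -> le (p q) (p r), forall q, exists n, p q = v n &
      forall n, exists q, p q = v n].
Proof.
have step (sk : seq (rat * nat) * nat) : exists s' : seq (rat * nat),
    mono_graph sk.1 -> [/\ mono_graph s', {subset sk.1 <= s'},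
      exists n, (odflt 0 (unpickle sk.2), n) \in s' &
      exists q, (q, sk.2) \in s'].
  case: sk => s k /=; have [ms|nms] := pselect (mono_graph s); last first.
    by exists s.
  have [n mn] := mono_graph_forth (odflt 0 (unpickle k)) ms.
  have [q mq] := mono_graph_back k mn; eexists => _; split; first exact: mq.
  - by move=> a sa; rewrite !inE sa !orbT.
  - by exists n; rewrite !inE eqxx orbT.
  - by exists q; rewrite mem_head.
have [F FP] := choice step.
pose S := fix S k := if k is k'.+1 then F (S k', k') else [::].
have mS k : mono_graph (S k) by elim: k => [//|k mk]; have [] := FP (S k, k) mk.
have sS k l : (k <= l)%N -> {subset S k <= S l}.
  elim: l => [|l IHl]; first by rewrite leqn0 => /eqP ->.
  rewrite leq_eqVlt => /predU1P[-> //|kl a /(IHl kl)].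
  by have [_ + _ _] := FP (S l, l) (mS l); apply.
have mU k l a b : a \in S k -> b \in S l -> a.1 <= b.1 -> le (v a.2) (v b.2).
  move=> ka lb; apply: (mS (maxn k l)).
    by apply: sS ka; exact: leq_maxl.
  by apply: sS lb; exact: leq_maxr.
have exn q : exists n, exists k, (q, n) \in S k.
  have [_ _ [n + _]] := FP (_, pickle q) (mS (pickle q)).
  by rewrite pickleK => /= qn; exists n, (pickle q).+1.
have [p pP] := choice exn.
exists (v \o p); split=> [q r qr||n].
- have [k qk] := pP q; have [l rl] := pP r.
  by apply: (mU _ _ _ _ qk rl).
- by move=> q; exists (p q).
(* The pair [(q, n)] may differ from the chosen [(q, p q)], but both sit over [q], so antisymmetry
   equates their values. *)
- have [_ _ _ [q qn]] := FP (_, n) (mS n); exists q.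
  have [k qk] := pP q.
  have {}qn : (q, n) \in S n.+1 by [].
  by apply: leT_anti; [apply: (mU _ _ _ _ qk qn)|apply: (mU _ _ _ _ qn qk)].
Qed.

End MonotoneSurjection.

(** The diagonal [d] is true at [h d], else [d] itself would witness it; a witness [x] there has the
    same value as [d] and differs from it at [h d]. *)
Lemma cantor_pigeonhole (h : (nat -> bool) -> nat) :
  exists x y : nat -> bool, x <> y /\ h x = h y.
Proof.
apply: contrapT => inj.
pose d n : bool := `[< exists x, h x = n /\ ~~ x n >].
have [dd|nd] := boolP (d (h d)); last by case/asboolP: (nd); exists d.
have /asboolP[x [hxd nx]] := dd.
apply: inj; exists x, d; split=> // xd.
by move: nx; rewrite xd dd.
Qed.

(** * Lexicographic order on sequences of numbers *)

Section LexicographicOrder.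
Implicit Types u v w : nat -> nat.

Definition lexlt u v : Prop :=
  exists m, (forall k, (k < m)%N -> u k = v k) /\ (u m < v m)%N.

Definition lexle u v : Prop := u = v \/ lexlt u v.

Lemma lexlt_trans u v w : lexlt u v -> lexlt v w -> lexlt u w.
Proof.
move=> [m [um uvm]] [n [vn vwn]]; exists (minn m n); split=> [k|].
  by rewrite leq_min => /andP[km kn]; rewrite um // vn.
case: (ltngtP m n) => [mn|nm|mn].
- by rewrite -vn.
- by rewrite um.
- by move: vwn; rewrite -mn; exact: ltn_trans.
Qed.

Lemma lexltxx u : ~ lexlt u u.
Proof. by move=> [m [_]]; rewrite ltnn. Qed.

Lemma lexle_trans u v w : lexle u v -> lexle v w -> lexle u w.
Proof.
by move=> [->//|uv] [<-|vw]; right=> //; exact: lexlt_trans vw.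
Qed.

Lemma lexle_lt_trans u v w : lexle u v -> lexlt v w -> lexlt u w.
Proof. by move=> [->//|]; exact: lexlt_trans. Qed.

Lemma lexle_anti u v : lexle u v -> lexle v u -> u = v.
Proof. by move=> [//|uv] [//|vu]; case: (lexltxx (lexlt_trans uv vu)). Qed.

Lemma first_difference (T : Type) (u v : nat -> T) : u <> v ->
  exists m, (forall k, (k < m)%N -> u k = v k) /\ u m <> v m.
Proof.
move=> uv; have ex : exists m, `[< u m <> v m >].
  apply: contrapT => nex; apply: uv; apply: funext => m.
  by apply: contrapT => uvm; apply: nex; exists m; apply/asboolP.
have [m /asboolP uvm minm] := ex_minnP ex; exists m; split=> // k km.
apply: contrapT => /asboolP /minm; lia.
Qed.

Lemma lexle_total u v : lexle u v \/ lexle v u.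
Proof.
have [->|/first_difference[m [uvm neq]]] := pselect (u = v).
  by left; left.
case: (ltngtP (u m) (v m)) => [lt|gt|//].
  by left; right; exists m.
by right; right; exists m; split=> // k /uvm.
Qed.

End LexicographicOrder.

(** * Copies of the rationals coded by lexicographic keys *)

Definition enum_rat (k : nat) : rat := odflt 0 (unpickle k).

Lemma enum_ratK q : enum_rat (pickle q) = q.
Proof. by rewrite /enum_rat pickleK. Qed.

Definition first_rats (m : nat) : seq rat := mkseq enum_rat m.+1.

Lemma first_ratsP m q :
  reflect (exists2 k, (k <= m)%N & q = enum_rat k) (q \in first_rats m).
Proof.
apply: (iffP mapP) => -[k km ->]; exists k => //.
  by move: km; rewrite mem_iota.
by rewrite mem_iota.
Qed.

Lemma first_rats_sub m n : (m <= n)%N -> {subset first_rats m <= first_rats n}.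
Proof.
move=> mn q /first_ratsP[k km ->]; apply/first_ratsP; exists k => //.
exact: leq_trans mn.
Qed.

(** Even values leave room for the bit added in [key]. *)
Definition side (q : rat) (m : nat) : nat :=
  if q < enum_rat m then 0%N else if q == enum_rat m then 2%N else 4%N.

Definition low (q : rat) (m : nat) : bool :=
  all (fun a => q < a) (first_rats m).

(* The level-m digit locates [q] with respect to the m-th rational; its parity
   is the m-th bit of [y], ignored once [q] has been enumerated. The bit is
   complemented below all of the first m + 1 rationals, so that for [x m = 0],
   [y m = 1] the x-copy of the unbounded bottom cell lies above its y-copy and
   is collapsed to the finite end of the cell, as happens in the other cells. *)
Definition key (y : nat -> bool) (q : rat) (m : nat) : nat :=
  (side q m + ((q \notin first_rats m) && (y m (+) low q m)))%N.

Definition same_sides (q r : rat) (m : nat) : Prop :=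
  forall k, (k <= m)%N -> side q k = side r k.

Lemma side_mono q r m : q <= r ->
  side q m = side r m \/ ((side q m).+1 < side r m)%N.
Proof.
rewrite /side => qr; case: (ltgtP r (enum_rat m)) => [rm|mr|rm].
- by left; rewrite (le_lt_trans qr rm).
- case: ltgtP => _; [by right|by left|by right].
- by rewrite -rm; case: ltgtP qr => // _ _; [right|left].
Qed.

Lemma same_sides_mem q r m :
  same_sides q r m -> q \in first_rats m -> q = r.
Proof.
move=> qr /first_ratsP[k km qk]; have := qr k km.
by rewrite /side -qk ltxx eqxx; case: ltgtP => // <-.
Qed.

Lemma same_sides_sym q r m : same_sides q r m -> same_sides r q m.
Proof. by move=> qr k /qr. Qed.

Lemma same_sides_low q r m : same_sides q r m -> low q m = low r m.
Proof.
move=> qr; apply: eq_in_all => a /first_ratsP[k km ->].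
by have := qr k km; rewrite /side; case: ifP; case: ifP => // _ _; case: ifP.
Qed.

Lemma key_eq_at x y q r m :
  same_sides q r m -> x m = y m -> key x q m = key y r m.
Proof.
move=> qr xy; rewrite /key qr // xy (same_sides_low qr).
have [qm|qm] := boolP (q \in first_rats m).
  by rewrite -(same_sides_mem qr qm) qm.
suff /negbTE -> : r \notin first_rats m by [].
by apply: contra qm => rm; rewrite -(same_sides_mem (same_sides_sym qr) rm).
Qed.

(** From level [m] on, [q] has been enumerated and the bits are ignored. Thus enumerated rationals
    are common to both branches. *)
Lemma key_agree x y q m : (forall k, (k < m)%N -> x k = y k) ->
  q \in first_rats m -> key x q = key y q.
Proof.
move=> xy qm; apply: funext => k; have [km|mk] := ltnP k m.
  by apply: key_eq_at => //; exact: xy.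
by rewrite /key (first_rats_sub mk qm).
Qed.

(** At the first level where the sides differ, their gap of two outweighs the bits; before it, equal
    sides give equal digits. *)
Lemma key_lt y q r : q < r -> lexlt (key y q) (key y r).
Proof.
move=> qr; have sides : side q <> side r.
  move=> /(congr1 (@^~ (pickle q))); rewrite /side enum_ratK ltxx eqxx.
  by case: ltgtP qr.
have [m [eqm neqm]] := first_difference sides; exists m; split=> [k km|].
  by apply: key_eq_at => // l lk; apply: eqm; exact: leq_ltn_trans km.
have [//|] := side_mono m (ltW qr); rewrite /key; lia.
Qed.

Lemma key_le y q r : q <= r -> lexle (key y q) (key y r).
Proof. by rewrite le_eqVlt => /predU1P[->|/(key_lt y)]; [left|right]. Qed.

(* The copies of a cell of the first m + 1 rationals along two branches that
   split at level m are entirely on one side of each other. *)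
Lemma key_cell x y q r m : (forall k, (k < m)%N -> x k = y k) ->
  q \notin first_rats m -> r \notin first_rats m ->
  (forall a, a \in first_rats m -> (q < a) = (r < a)) ->
  x m (+) low q m = false -> y m (+) low q m ->
  lexlt (key x q) (key y r).
Proof.
move=> xy qm rm cell xm ym; have qr : same_sides q r m.
  move=> k km; have km' : enum_rat k \in first_rats m.
    by apply/first_ratsP; exists k.
  rewrite /side cell //; case: ifP => // _.
  case: eqP => [qk|_]; first by rewrite qk km' in qm.
  by case: eqP => // rk; rewrite rk km' in rm.
exists m; split=> [k km|].
  apply: key_eq_at; last exact: xy.
  by move=> l lk; apply: qr; exact: leq_trans lk (ltnW km).
by rewrite /key qr // qm rm xm -(same_sides_low qr) ym addn0 addn1.
Qed.

(** * Relative position of two branches *)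

Section KeysOfTwoBranches.
Variables (y z : nat -> bool) (m : nat) (q : rat).
Hypotheses (agree : forall k, (k < m)%N -> y k = z k) (split_m : y m != z m)
  (qm : q \notin first_rats m).

(** Either an enumerated [d] lies between [q] and [r], and its common key separates them, or [r] is
    in the cell of [q] and the bit at level [m] decides. *)
Lemma key_below r : z m (+) low q m = false ->
  (forall d, d \in first_rats m -> d < q -> d < r) ->
  lexlt (key z q) (key y r).
Proof.
move=> zm qr.
have [[d [dm qd dr]]|nd] :=
    pselect (exists d, [/\ d \in first_rats m, q < d & d <= r]).
  have := key_lt z qd; rewrite -(key_agree agree dm) => h.
  by have [<-|] := key_le y dr; [|exact: lexlt_trans].
have cell a : a \in first_rats m -> (q < a) = (r < a).
  move=> am; apply/idP/idP => [qa|ra].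
    by rewrite ltNge; apply/negP => ar; apply: nd; exists a.
  rewrite ltNge; apply/negP => aq; suff : a < r by rewrite ltNge (ltW ra).
  apply: qr => //; rewrite lt_neqAle aq andbT.
  by apply: contraNneq qm => <-.
apply: (@key_cell _ _ _ _ m) => //; first by move=> k /agree.
  apply/negP => rm; have := cell _ rm; rewrite ltxx.
  case: ltgtP => // [rq|rq] _; last by move: qm; rewrite rq rm.
  by have := qr _ rm rq; rewrite ltxx.
by move: zm split_m; case: (y m); case: (z m); case: (low q m).
Qed.

Lemma key_above r : z m (+) low q m ->
  (forall d, d \in first_rats m -> q < d -> r < d) ->
  lexlt (key y r) (key z q).
Proof.
move=> zm qr.
have [[d [dm rd dq]]|nd] :=
    pselect (exists d, [/\ d \in first_rats m, r <= d & d < q]).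
  have := key_lt z dq; rewrite -(key_agree agree dm) => h.
  by have [->|] := key_le y rd; [|move=> /lexlt_trans; apply].
have cell a : a \in first_rats m -> (q < a) = (r < a).
  move=> am; apply/idP/idP => [|ra]; first exact: qr.
  rewrite ltNge; apply/negP => aq; apply: nd; exists a; split=> //.
    exact: ltW.
  by rewrite lt_neqAle aq andbT; apply: contraNneq qm => <-.
have rm : r \notin first_rats m.
  apply/negP => rm; have := cell _ rm; rewrite ltxx.
  case: ltgtP => // [rq|rq] _; last by move: qm; rewrite rq rm.
  by apply: nd; exists r.
have lowE : low r m = low q m by apply: eq_in_all => a /cell.
apply: (@key_cell _ _ _ _ m) => //; rewrite ?lowE //.
- by move=> a /cell.
- by move: zm split_m; case: (y m); case: (z m); case: (low q m).
Qed.

End KeysOfTwoBranches.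

(** A lower set with supremum [a], attained or not. *)
Definition cut_at (S : rat -> Prop) (a : rat) : Prop :=
  (forall q, q < a -> S q) /\ (forall q, S q -> q <= a).

Lemma cut_at_mono (S S' : rat -> Prop) a a' :
  (forall q, S q -> S' q) -> cut_at S a -> cut_at S' a' -> a <= a'.
Proof.
move=> SS' [aS _] [_ S'a']; rewrite leNgt; apply/negP => lt.
have : (a + a') / 2 < a by lra.
by move=> /aS /SS' /S'a'; lra.
Qed.

Lemma key_cut y q : cut_at (fun r => lexle (key y r) (key y q)) q.
Proof.
split=> r; first by move=> /ltW /key_le.
rewrite leNgt => rq; apply/negP => /(key_lt y) qr.
exact: lexltxx (lexle_lt_trans rq qr).
Qed.

(** If [q] is not enumerated, its cell collapses to its upper or lower end, according as the copy
    along [z] lies above or below the one along [y]. That end is infinite only for the top cell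
    upwards and the bottom cell downwards; the complemented bit makes [z m] true in both cases. *)
Lemma keys_cut y z m q :
  (forall k, (k < m)%N -> y k = z k) -> y m != z m ->
  (exists2 a, a \in first_rats m &
     cut_at (fun r => lexle (key y r) (key z q)) a) \/
  z m /\ ((forall r, ~ lexle (key y r) (key z q)) \/
          (forall r, lexle (key y r) (key z q))).
Proof.
move=> agree split_m.
have [qm|qm] := boolP (q \in first_rats m).
  by left; exists q => //; rewrite -(key_agree agree qm); exact: key_cut.
have [zm|/negbTE zm] := boolP (z m (+) low q m).
  have [no|[c [cm qc cmin]]] :=
      filter_has_max -%R (first_rats m) (fun c => q < c).
    right; split; last first.
      right=> r; right; apply: key_above zm _ => // d dm qd.
      by have := no _ dm; rewrite qd.
    (* [first_rats m] is nonempty, so the top cell is not the bottom cell. *)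
    have : ~~ low q m.
      apply/negP => /allP /(_ (enum_rat 0)) h.
      have e0 : enum_rat 0 \in first_rats m by apply/first_ratsP; exists 0%N.
      by have := no _ e0; rewrite h.
    by move: zm; case: (z m); case: (low q m).
  left; exists c => //; split=> r.
    move=> rc; right; apply: key_above zm _ => // d dm qd.
    by apply: lt_le_trans rc _; have := cmin _ dm qd; rewrite lerN2.
  move=> rq; rewrite leNgt; apply/negP => cr; apply: (@lexltxx (key y r)).
  apply: lexle_lt_trans rq _; apply: lexlt_trans (key_lt z qc) _.
  by rewrite -(key_agree agree cm); exact: key_lt.
have [no|[a [am aq amax]]] :=
    filter_has_max id (first_rats m) (fun a => a < q).
  right; split; last first.
    left=> r rq; apply: (@lexltxx (key z q)).
    have : lexlt (key z q) (key y r).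
      apply: key_below zm _ => // d dm dq.
      by have := no _ dm; rewrite dq.
    by move=> h; case: (lexltxx (lexle_lt_trans rq h)).
  have : low q m.
    apply/allP => a am; have := no _ am; rewrite -leNgt le_eqVlt.
    by case/predU1P => // qa; rewrite qa am in qm.
  by move: zm; case: (z m); case: (low q m).
left; exists a => //; split=> r.
  move=> ra; right; apply: lexlt_trans (key_lt y ra) _.
  by rewrite (key_agree agree am); exact: key_lt.
move=> rq; rewrite leNgt; apply/negP => ar; apply: (@lexltxx (key y r)).
apply: lexle_lt_trans rq _; apply: key_below zm _ => // d dm dq.
by apply: le_lt_trans ar; exact: amax.
Qed.

(** * Truncations and truncated suprema *)

Definition clamp (L q : rat) : rat :=
  if q <= - L then - L else if L <= q then L else q.

Variant clamp_spec (L q : rat) : rat -> Prop :=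
  | ClampLow of q <= - L : clamp_spec L q (- L)
  | ClampHigh of - L < q & L <= q : clamp_spec L q L
  | ClampId of - L < q & q < L : clamp_spec L q q.

Lemma clampP L q : clamp_spec L q (clamp L q).
Proof.
rewrite /clamp; case: (leP q (- L)) => [|low_q]; first exact: ClampLow.
by case: (leP L q) => [|q_high]; [exact: ClampHigh|exact: ClampId].
Qed.

Lemma clamp_homo L : 0 <= L -> {homo clamp L : q r / q <= r}.
Proof. by move=> L0 q r qr; case: clampP; case: clampP => *; lra. Qed.

Lemma clamp_id L q : `|q| <= L -> clamp L q = q.
Proof. by rewrite ler_norml => /andP[Lq qL]; case: clampP => *; lra. Qed.

Lemma clamp_bounds L q : 0 <= L -> - L <= clamp L q <= L.
Proof. by move=> L0; case: clampP => *; lra. Qed.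

(** The supremum of [S] over the interval from [- L] to [L], or [- L] if [S] misses it; truncation
    gives empty and full sets a rational value. *)
Definition lub_in (L : rat) (S : rat -> Prop) (r : rat) : Prop :=
  [/\ - L <= r, forall q, - L <= q <= L -> S q -> q <= r &
      forall r', - L <= r' -> (forall q, - L <= q <= L -> S q -> q <= r') ->
        r <= r'].

Lemma lub_in_mono L (S S' : rat -> Prop) r r' : (forall q, S q -> S' q) ->
  lub_in L S r -> lub_in L S' r' -> r <= r'.
Proof.
move=> SS' [_ _ rmin] [r'L r'ub _]; apply: rmin => // q qL /SS'.
exact: r'ub.
Qed.

Lemma lub_in_cut L S a : 0 <= L -> cut_at S a -> lub_in L S (clamp L a).
Proof.
move=> L0 [aS Sa]; have := clamp_bounds a L0 => cL; split.
- by case/andP: cL.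
- by move=> q /andP[Lq qL] /Sa qa; case: clampP => *; lra.
- move=> r rL rub; rewrite leNgt; apply/negP => rc.
  suff : (r + clamp L a) / 2 <= r by lra.
  apply: rub; first by case/andP: cL => *; lra.
  by apply: aS; move: rc rL; case: clampP => *; lra.
Qed.

Lemma lub_in_empty L S : (forall q, ~ S q) -> lub_in L S (- L).
Proof. by move=> S0; split=> // q _ /S0. Qed.

Lemma lub_in_full L S : 0 <= L -> (forall q, S q) -> lub_in L S L.
Proof.
move=> L0 ST; split=> [|q /andP[]//|r _]; first lra.
by apply=> //; lra.
Qed.

Lemma keys_lub L y z q : 0 <= L ->
  exists r, lub_in L (fun t => lexle (key y t) (key z q)) r.
Proof.
move=> L0; have [->|/first_difference[m [yz neq]]] := pselect (y = z).
  by exists (clamp L q); apply: lub_in_cut => //; exact: key_cut.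
have /eqP split_m := neq.
have [[a _ cut_a]|[_ [S0|ST]]] := keys_cut q yz split_m.
- by exists (clamp L a); exact: lub_in_cut.
- by exists (- L); exact: lub_in_empty.
- by exists L; exact: lub_in_full.
Qed.

(** * The chain of all keys *)

Definition enum_key (n : nat) : nat -> nat :=
  let sk := odflt ([::], 0) (unpickle n : option (seq bool * rat)) in
  key (nth false sk.1) sk.2.

(** A key uses only the bits before [q] is enumerated, so all branches together have countably many
    keys. *)
Lemma key_enum y q : exists n, key y q = enum_key n.
Proof.
exists (pickle (mkseq y (pickle q), q)); rewrite /enum_key pickleK /=.
apply: (@key_agree _ _ _ (pickle q)) => [k kq|]; first by rewrite nth_mkseq.
by apply/first_ratsP; exists (pickle q); rewrite ?enum_ratK.
Qed.

(** [p] runs monotonically through all keys and [J y] picks preimages of the keys along [y]; it is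
    monotone because these keys increase strictly. *)
Lemma rational_keys : exists (p : rat -> nat -> nat)
    (J : (nat -> bool) -> rat -> rat),
  [/\ forall q r, q <= r -> lexle (p q) (p r),
      forall t, exists z q, p t = key z q,
      forall y, {homo J y : q r / q <= r} &
      forall y q, p (J y q) = key y q].
Proof.
have [p [p_homo p_enum p_surj]] :=
  monotone_surjection enum_key lexle_trans lexle_anti lexle_total.
have exJ (yq : (nat -> bool) * rat) : exists t, p t = key yq.1 yq.2.
  by have [n ->] := key_enum yq.1 yq.2; exact: p_surj.
have [J JP] := choice exJ.
exists p, (fun y q => J (y, q)); split=> // [t|y q r].
- by have [n ->] := p_enum t; rewrite /enum_key; do 2 eexists.
- rewrite le_eqVlt => /predU1P[->//|/(key_lt y) qr].
  rewrite leNgt; apply/negP => /ltW /p_homo; rewrite !JP /= => rq.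
  exact: lexltxx (lexle_lt_trans rq qr).
Qed.

(** * Actions of monotone maps on a countable set *)

Section MonotoneAction.
Variables (Omega : countType) (act : (rat -> rat) -> Omega -> Omega).
Hypothesis actM : forall f g b, {homo f : q r / q <= r} ->
  {homo g : q r / q <= r} -> act (f \o g) b = act f (act g b).

Lemma clamp_stabilizes b : exists g (s : seq rat) K,
  [/\ {homo g : q r / q <= r}, forall q, g q \in s &
      forall L, K <= L -> act (clamp L) b = act g b].
Proof.
have [p [J [p_homo p_key J_homo pJ]]] := rational_keys.
have [x [y [neq_xy same_xy]]] :=
  cantor_pigeonhole (fun y => pickle (act (J y) b)).
have {same_xy} same_xy : act (J x) b = act (J y) b.
  exact: pcan_inj pickleK _ _ same_xy.
(* The pair is ordered so that [x m] is false, which excludes the unbounded alternatives of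
   [keys_cut] with [x] as [z]. *)
wlog [m [agree xm ym]] : x y neq_xy same_xy /
    exists m, [/\ forall k, (k < m)%N -> y k = x k, ~~ x m & y m].
  move=> wl; have [m [agree neq]] := first_difference neq_xy.
  have [xm|xm] := boolP (x m); last first.
    apply: (wl x y) => //; exists m; split=> // [k /agree//|].
    by move: neq xm; case: (x m); case: (y m).
  apply: (wl y x) => //; first by move=> yx; exact: neq_xy.
  by exists m; split=> //; move: neq; rewrite xm; case: (y m).
have split_m : y m != x m by rewrite ym (negbTE xm).
have exg q : exists a, a \in first_rats m /\
    cut_at (fun t => lexle (key y t) (key x q)) a.
  have [[a am cut_a]|[xm' _]] := keys_cut q agree split_m; first by exists a.
  by rewrite xm' in xm.
have [g gP] := choice exg.
have g_homo : {homo g : q r / q <= r}.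
  move=> q r qr; have [_ gq] := gP q; have [_ gr] := gP r.
  apply: cut_at_mono gq gr => t tq.
  exact: lexle_trans tq (key_le x qr).
have [K [K0 gK]] : exists K, 0 <= K /\ forall q, `|g q| <= K.
  have [s0|[a _ amax]] := seq_has_max Num.norm (first_rats m).
    by have [] := gP 0; rewrite s0.
  by exists `|a|; split=> // q; have [/amax] := gP q.
exists g, (first_rats m), K; split=> // [q|L KL]; first by have [] := gP q.
have L0 : 0 <= L := le_trans K0 KL.
(* [R] sends [t] to the truncated supremum of the rationals whose key along [y] is at most [p t],
   and so inverts [J y] up to truncation. *)
have exR t : exists r, lub_in L (fun u => lexle (key y u) (p t)) r.
  by have [z [q ->]] := p_key t; exact: keys_lub.
have [R RP] := choice exR.
have R_homo : {homo R : q r / q <= r}.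
  move=> q r qr; apply: lub_in_mono (RP q) (RP r) => t tq.
  exact: lexle_trans tq (p_homo _ _ qr).
have R_uniq z q a : cut_at (fun t => lexle (key y t) (key z q)) a ->
    R (J z q) = clamp L a.
  move=> /(lub_in_cut L0) lub_a; have := RP (J z q); rewrite pJ => lub_R.
  by apply/eqP; rewrite eq_le (lub_in_mono _ lub_R lub_a) //
    (lub_in_mono _ lub_a lub_R).
have RJy : R \o J y = clamp L.
  by apply: funext => q; apply: R_uniq; exact: key_cut.
have RJx : R \o J x = g.
  apply: funext => q; have [_ /R_uniq /= ->] := gP q.
  by apply: clamp_id; exact: le_trans (gK q) KL.
rewrite -RJy -RJx (actM b R_homo (J_homo y)) (actM b R_homo (J_homo x)).
by rewrite same_xy.
Qed.

End MonotoneAction.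

(** * Neighbourhoods in the pointwise topology *)

Section OperationTopology.
Variables (A : choiceType) (n : nat) (f : op A n).

Lemma nbhs_op_point (x : 'I_n -> A) : nbhs f [set g : op A n | g x = f x].
Proof.
have /cvg_sup/(_ x) cvx : nbhs f --> f by exact: cvg_id.
have := @initial_continuous (op A n) (discrete_topology A) (fun g => g x) f.
move=> /(_ [set f x]) h; apply: cvx; apply: h.
by rewrite nbhs_principalE; exact/principal_filterP.
Qed.

Lemma nbhs_op (B : set (op A n)) :
  nbhs f B <-> exists s : seq ('I_n -> A),
    forall g : op A n, (forall x, x \in s -> g x = f x) -> B g.
Proof.
pose F : set_system (op A n) := fun B => exists s : seq ('I_n -> A),
    forall g : op A n, (forall x, x \in s -> g x = f x) -> B g.
have FF : Filter F.
  split; first by exists [::].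
    move=> P Q [s sP] [t tQ]; exists (s ++ t) => g gst; split.
      by apply: sP => x sx; apply: gst; rewrite mem_cat sx.
    by apply: tQ => x tx; apply: gst; rewrite mem_cat tx orbT.
  by move=> P Q PQ [s sP]; exists s => g /sP /PQ.
split; last first.
  move=> [s]; elim: s B => [|x s IHs] B sB.
    by apply: filterS filterT => g _; exact: sB.
  have : nbhs f [set g : op A n | g x = f x -> B g].
    by apply: IHs => g gs gx; apply: sB => y; rewrite inE => /predU1P[->|/gs].
  apply: filterS2 (nbhs_op_point x) => g /= gx; exact.
suff : F --> f by apply.
apply/cvg_sup => x C [_ [[V oV <-] Vf] VC]; exists [:: x] => g gx.
by apply: VC; rewrite /= gx ?mem_head.
Qed.

Lemma nbhs_ops (B : set (ops A)) :
  nbhs (mkops f) B <-> exists s : seq ('I_n -> A),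
    forall g : op A n, (forall x, x \in s -> g x = f x) -> B (mkops g).
Proof. exact: nbhs_op. Qed.

End OperationTopology.

Lemma mkops_inj (A : choiceType) (n : nat) : injective (@mkops A n).
Proof. by move=> f g; exact: existT_inj2. Qed.

(** * Clones generated by unary maps *)

Section EssentiallyUnary.
Variables (A : choiceType) (M : set (A -> A)).

Lemma clone_gen_proj n (i : 'I_n) : clone_gen M (mkops (op_proj A i)).
Proof. by move=> C [[Cproj _] _]; exact: Cproj. Qed.

Lemma clone_gen_op_unary u : M u -> clone_gen M (mkops (op_unary u)).
Proof. by move=> Mu C [_]; apply; exists u. Qed.

Lemma clone_gen_unary : M id -> (forall f g, M f -> M g -> M (f \o g)) ->
  forall n (a : op A n), clone_gen M (mkops a) ->
  exists f (i : 'I_n), M f /\ a = fun x => f (x i).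
Proof.
move=> Mid Mcomp n a.
pose C : set (ops A) := [set o | exists f (i : 'I_(tag o)),
  M f /\ tagged o = fun x => f (x i)].
suff : clone_gen M `<=` C by move=> /(_ (mkops a)).
apply: smallest_sub => [|_ [u Mu <-]]; last by exists u, ord0.
split=> [m i|m k f g [f0 [i [Mf0 /= ->]]] Cg]; first by exists id, i.
have [g0 [j [Mg0 /= gi]]] := Cg i.
by exists (f0 \o g0), j; split; [exact: Mcomp|rewrite /op_comp /= gi].
Qed.

End EssentiallyUnary.

(** * Isomorphisms onto closed clones *)

Section Reconstruction.
Variables (M : set (rat -> rat)) (Omega : countType) (E : set (ops Omega)).
Variable phi : forall n, op rat n -> op Omega n.
Arguments phi [n] _.
Hypotheses (homoM : forall f, {homo f : q r / q <= r} -> M f)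
  (compM : forall f g, M f -> M g -> M (f \o g))
  (closedE : closed E) (phi_iso : clone_iso (clone_gen M) E phi).

Let D := clone_gen M.

Let phi_proj n (i : 'I_n) : phi (op_proj rat i) = op_proj Omega i.
Proof. by case: phi_iso. Qed.

Let phi_comp m n (f : op rat m) (g : 'I_m -> op rat n) :
  D (mkops f) -> (forall i, D (mkops (g i))) ->
  phi (op_comp f g) = op_comp (phi f) (fun i => phi (g i)).
Proof. by case: phi_iso => _ _; apply. Qed.

Let cstM q : M (cst q).
Proof. by apply: homoM => r s. Qed.

Let idM : M id.
Proof. by apply: homoM. Qed.

Let DU u : M u -> D (mkops (op_unary u)).
Proof. exact: clone_gen_op_unary. Qed.
Arguments DU {u} _.

Definition act (f : rat -> rat) (b : Omega) : Omega :=
  phi (op_unary f) (fun=> b).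

Lemma phi_unary n (i : 'I_n) f x : M f ->
  phi (fun y => f (y i) : discrete_topology rat) x = act f (x i).
Proof.
move=> Mf; have := @phi_comp 1 n (op_unary f) (fun=> op_proj rat i) (DU Mf).
move=> /(_ (fun=> @clone_gen_proj _ M n i)) h.
rewrite [LHS](congr1 (@^~ x) h) /op_comp /act; congr (phi _ _).
by apply: funext => j; rewrite phi_proj.
Qed.

Lemma act_comp f g b : M f -> M g -> act (f \o g) b = act f (act g b).
Proof.
move=> Mf Mg; have := @phi_comp 1 1 (op_unary f) (fun=> op_unary g) (DU Mf).
by move=> /(_ (fun=> DU Mg)) /(congr1 (@^~ (fun=> b))).
Qed.

(** The binary constant [q] factors through both projections, so its image at [(b, c)] is computed
    from either coordinate alone. *)
Lemma act_cst q b c : act (cst q) b = act (cst q) c.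
Proof.
pose x (i : 'I_2) := if i == ord0 then b else c.
have -> : b = x ord0 by [].
have -> : c = x (lift ord0 ord0) by [].
by rewrite -!phi_unary.
Qed.

Section BasePoint.
Variable b0 : Omega.

Definition theta (q : rat) : Omega := act (cst q) b0.

(** Substituting the constants [x i] into [a] yields the constant [a x], and [phi] preserves this
    composition. *)
Lemma phi_theta n (a : op rat n) x :
  D (mkops a) -> phi a (theta \o x) = theta (a x).
Proof.
move=> Da; have := @phi_comp n 1 a (fun i => op_unary (cst (x i))) Da.
by move=> /(_ (fun i => DU (cstM _))) /(congr1 (@^~ (fun=> b0))) /esym.
Qed.

Lemma theta_inj : injective theta.
Proof.
move=> q r qr.
have phi_qr : phi (op_unary (cst q)) = phi (op_unary (cst r)).
  apply: funext => x; have -> : x = fun=> x ord0.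
    by apply: funext => i; rewrite ord1.
  by rewrite -![phi _ _]/(act _ _) (act_cst q _ b0) (act_cst r _ b0).
have [[_ phi_inj _] _ _] := phi_iso.
have := phi_inj (mkops (op_unary (cst q))) (mkops (op_unary (cst r))).
move=> /(_ (mem_set (DU (cstM _))) (mem_set (DU (cstM _)))).
rewrite /ops_map /= phi_qr => /(_ erefl).
by move=> /mkops_inj /(congr1 (@^~ (fun=> 0))).
Qed.

Lemma act_theta f q : M f -> act f (theta q) = theta (f q).
Proof. by move=> /DU Df; exact: (@phi_theta 1 (op_unary f) (fun=> q) Df). Qed.

(** Finitely many arguments admit a common threshold, so [lam] is in the closure of the images of
    truncations. *)
Lemma clamp_limit_in (lam : op Omega 1) :
  (forall x, exists K, forall L, K <= L ->
     phi (op_unary (clamp L)) x = lam x) ->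
  E (mkops lam).
Proof.
move=> limE; apply: closedE => B /nbhs_ops[s sB].
have [K KP] := choice limE.
(* Nonnegativity makes [clamp K0] monotone. *)
have [K0 [K0_ge0 K0P]] : exists K0, 0 <= K0 /\ forall x, x \in s -> K x <= K0.
  have [->|[x _ xmax]] := seq_has_max K s; first by exists 0.
  exists (Num.max 0 (K x)); split=> [|y /xmax yx].
    by rewrite le_max lexx.
  by rewrite le_max yx orbT.
exists (mkops (phi (op_unary (clamp K0)))); split; last first.
  by apply: sB => x /K0P; exact: KP.
have [[phi_fun _ _] _ _] := phi_iso.
apply: (phi_fun (mkops (op_unary (clamp K0)))).
by apply: DU; apply: homoM; exact: clamp_homo.
Qed.

Lemma finite_stabilizer b : exists g (s : seq rat),
  [/\ M g, forall q, g q \in s & act g b = b].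
Proof.
have actM f g c : {homo f : q r / q <= r} -> {homo g : q r / q <= r} ->
    act (f \o g) c = act f (act g c).
  by move=> /homoM Mf /homoM Mg; exact: act_comp.
have [G GP] := choice (clamp_stabilizes actM).
pose lam : op Omega 1 := fun x => act (G (x ord0)) (x ord0).
have Elam : E (mkops lam).
  apply: clamp_limit_in => x; have [s [K [_ _ KP]]] := GP (x ord0).
  exists K => L /KP; apply: etrans; congr (phi _ _).
  by apply: funext => i; rewrite ord1.
have [[_ _ phi_surj] _ _] := phi_iso.
have [[n a] Da phi_a] := phi_surj _ Elam.
have n1 : n = 1%N := congr1 tag phi_a.
move: a Da phi_a; rewrite n1 => a Da /mkops_inj phi_a.
(* Large truncations fix [theta q], hence so does their limit [lam]; as [theta] is injective, [a]
   fixes every rational. *)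
have aE : a = op_proj rat ord0.
  apply: funext => x; have -> : x = fun=> x ord0.
    by apply: funext => i; rewrite ord1.
  apply: theta_inj; rewrite -phi_theta // phi_a /lam /=.
  have [s [K [_ _ KP]]] := GP (theta (x ord0)).
  have [L0 KL qL] : [/\ 0 <= Num.max K `|x ord0|, K <= Num.max K `|x ord0| &
      `|x ord0| <= Num.max K `|x ord0|].
    by rewrite !le_max !lexx normr_ge0 !orbT.
  rewrite -(KP _ KL) act_theta ?clamp_id //.
  exact: homoM _ (clamp_homo L0).
have [s [K [G_homo Gs _]]] := GP b; exists (G b), s; split=> //.
  exact: homoM.
have := congr1 (@^~ (fun=> b)) phi_a.
by rewrite aE phi_proj /lam /op_proj /= => <-.
Qed.

Lemma finite_support b : exists s : seq rat, forall f g, M f -> M g ->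
  {in s, f =1 g} -> act f b = act g b.
Proof.
have [h [s [Mh hs hb]]] := finite_stabilizer b; exists s => f g Mf Mg fg.
rewrite -hb -!act_comp //; congr (act _ _).
by apply: funext => q /=; exact: fg.
Qed.

Lemma phi_continuous : {within D, continuous (ops_map phi)}.
Proof.
apply/subspace_continuousP => -[n a] Da B /nbhs_ops[s sB].
have [f [i [Mf aE]]] := @clone_gen_unary _ M idM compM _ _ Da.
have [S SP] := choice finite_support.
pose T := flatten [seq flatten [seq S (x j) | j <- enum 'I_n] | x <- s].
have TP x j g h : x \in s -> M g -> M h -> {in T, g =1 h} ->
    act g (x j) = act h (x j).
  move=> sx Mg Mh gh; apply: SP => // q qS; apply: gh.
  apply/flatten_mapP; exists x => //; apply/flatten_mapP; exists j => //.
  by rewrite mem_enum.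
apply/nbhs_ops.
(* These tuples test both the values of [f] on the joint support [T] and, since entries off [i] vary
   separately, the coordinate used. *)
exists [seq (fun k => if k == i then p else q) | p <- T, q <- T] => a' agree Da'.
apply: sB => x sx.
have [f' [j [Mf' a'E]]] := @clone_gen_unary _ M idM compM _ _ Da'.
have {}agree p q : p \in T -> q \in T ->
    f' (if j == i then p else q) = f p.
  move=> pT qT; have := agree (fun k => if k == i then p else q).
  by rewrite a'E aE eqxx; apply; apply: allpairs_f.
rewrite /= a'E aE !phi_unary //.
have ff' : {in T, f' =1 f}.
  by move=> q qT; have := agree q q qT qT; rewrite if_same.
rewrite (TP x j f' f) //; have [->//|ji] := eqVneq j i.
(* Agreement despite reading another coordinate forces [f] to be constant on [T], so it acts there
   as a constant, whose argument is irrelevant. *)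
have fc : {in T, f =1 cst (f (head 0 T))}.
  move=> q qT /=.
  have hT : head 0 T \in T by case: (T) qT => // *; exact: mem_head.
  have := agree _ _ hT qT; rewrite (negbTE ji) => <-.
  by rewrite ff'.
by rewrite (TP x j f _ sx Mf (cstM _) fc) (TP x i f _ sx Mf (cstM _) fc) (act_cst _ _ (x i)).
Qed.

(** Values at tuples [theta \o x] determine those of the preimage at [x], as [theta] is
    injective. *)
Lemma phi_inverse_continuous : exists g : ops Omega -> ops rat,
  {in D, cancel (ops_map phi) g} /\ {within E, continuous g}.
Proof.
have [[phi_fun phi_inj phi_surj] _ _] := phi_iso.
have exg e : exists d, E e -> D d /\ ops_map phi d = e.
  have [/phi_surj[d Dd de]|nEe] := pselect (E e); first by exists d.
  by exists (mkops (op_unary id)).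
have [g gP] := choice exg; exists g; split.
  move=> d /set_mem Dd; have [Dg gd] := gP _ (phi_fun _ Dd).
  by apply: phi_inj => //; exact: mem_set.
apply/subspace_continuousP => e Ee B; have [] := gP _ Ee.
suff : D (g e) -> ops_map phi (g e) = e -> nbhs (g e) B ->
  nbhs e [set e' | E e' -> B (g e')] by [].
case: (g e) => n a Da <- /nbhs_ops[s sB]; apply/nbhs_ops.
exists [seq theta \o x | x <- s] => b agree Eb.
have [] := gP _ Eb; rewrite /preimage /=; case: (g _) => m a' Da' phi_a'.
have mn : m = n := congr1 tag phi_a'.
move: a' Da' phi_a'; rewrite mn => a' Da' /mkops_inj phi_a'.
apply: sB => x sx; apply: theta_inj.
rewrite -!phi_theta // phi_a'; apply: agree.
by apply/mapP; exists x.
Qed.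

End BasePoint.

Lemma phi_homeomorphism : homeomorphism_on D E (ops_map phi).
Proof.
(* On an empty [Omega] all unary operations coincide, yet [phi] separates the constants 0 and 1. *)
have [b0] : exists b : Omega, True.
  apply: contrapT => no.
  have phi01 : phi (op_unary (cst 0)) = phi (op_unary (cst 1)).
    by apply: funext => x; case: no; exists (x ord0).
  have [[_ phi_inj _] _ _] := phi_iso.
  have := phi_inj (mkops (op_unary (cst 0))) (mkops (op_unary (cst 1))).
  move=> /(_ (mem_set (DU (cstM _))) (mem_set (DU (cstM _)))).
  rewrite /ops_map /= phi01 => /(_ erefl).
  by move=> /mkops_inj /(congr1 (@^~ (fun=> 0))).
move=> _; split; first by case: phi_iso.
  exact: phi_continuous b0.
exact: phi_inverse_continuous b0.
Qed.

End Reconstruction.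

(** * Application to the three relations *)

Lemma automatic_homeomorphicity_monoid (M : set (rat -> rat)) :
  (forall f, {homo f : q r / q <= r} -> M f) ->
  (forall f g, M f -> M g -> M (f \o g)) ->
  automatic_homeomorphicity (clone_gen M).
Proof.
by move=> homoM compM Omega E _ closedE phi; exact: phi_homeomorphism.
Qed.

Lemma circ_homo (u : rat -> rat) : {homo u : q r / q <= r} ->
  forall x y z, circ x y z -> circ (u x) (u y) (u z).
Proof.
by move=> hu x y z /or3P[] /andP[/hu xy /hu yz]; apply/or3P;
  [constructor 1|constructor 2|constructor 3]; rewrite xy.
Qed.

Theorem theorem6p4 :
  automatic_homeomorphicity (clone_gen (End3 betw)) /\
  automatic_homeomorphicity (clone_gen (End3 circ)) /\
  automatic_homeomorphicity (clone_gen (End4 sep)).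
Proof.
split; [|split]; apply: automatic_homeomorphicity_monoid.
- by move=> u hu x y z /orP[] /andP[/hu xy /hu yz]; apply/orP;
    [left|right]; rewrite xy.
- by move=> f g Mf Mg x y z /Mg /Mf.
- by move=> u; exact: circ_homo.
- by move=> f g Mf Mg x y z /Mg /Mf.
- by move=> u hu x y z t /orP[] /andP[/(circ_homo hu) c1 /(circ_homo hu) c2];
    apply/orP; [left|right]; rewrite c1.
- by move=> f g Mf Mg x y z t /Mg /Mf.
Qed.
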